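(* Let $G$ be a hypercube graph on $\pm[n]$. The normal fan of every standard cut hypercube graph associahedron of $G$ is a fan that coarsens the type $B_n$ Coxeter fan.
   Context: Let $\pm[n]=\{-n,\dots,-1,1,\dots,n\}$. A hypercube graph is a graph $G$ on vertex set $\pm[n]$ with no edge of the form $\{i,-i\}$. A tube of $G$ is a nonempty set $t\subset\pm[n]$ that induces a connected subgraph of $G$ and contains no pair $\{i,-i\}$. Two tubes $t_1,t_2$ are weakly compatible if $t_1\subset t_2$, or $t_2\subset t_1$, or $t_1\cap t_2=\emptyset$ and no edge of $G$ joins $t_1$ to $t_2$. A tubing is a set $T$ of pairwise weakly compatible tubes whose union $\bigcup_{t\in T}t$ contains no pair $\{i,-i\}$; tubings form the tubing complex. The dual simplicial complex of a simple polytope is the complex of sets of facets with nonempty intersection. A hypercube graph associahedron of $G$ is a simple $n$-dimensional polytope whose dual simplicial complex is isomorphic to the tubing complex of $G$. In $\mathbb{R}^n$ let $e_1,\dots,e_n$ be the standard basis and $e_{-i}=-e_i$. For a tubing $T$ let $K_T$ be the cone of nonnegative linear combinations of the vectors $\sum_{i\in t}e_i$, $t\in T$. A standard cut hypercube graph associahedron of $G$ is a hypercube graph associahedron of $G$ in $\mathbb{R}^n$ whose normal fan equals the fan $\{K_T\mid T\text{ a tubing of }G\}$. The type $B_n$ Coxeter fan is the fan in $\mathbb{R}^n$ cut out by the hyperplanes $x_i=x_j$, $x_i=-x_j$ ($i\ne j$) and $x_i=0$, $i,j\in[n]$. A fan $\mathcal{F}$ coarsens a fan $\mathcal{F}'$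 if they have the same support and every cone of $\mathcal{F}$ is a union of cones of $\mathcal{F}'$. *)

(* Defs.v *)
From mathcomp Require Import all_boot all_order all_algebra.
From mathcomp Require Import all_classical all_reals.
From mathcomp Require Import convex.

Set Implicit Arguments.
Unset Strict Implicit.
Unset Printing Implicit Defensive.

Import Order.TTheory GRing.Theory Num.Theory.

Local Open Scope classical_set_scope.
Local Open Scope ring_scope.

(* The set {-n, ..., -1, 1, ..., n}: the pair (i, b) stands for i + 1 if b is
   false and for -(i + 1) if b is true. *)
Definition signed (n : nat) : finType := ('I_n * bool)%type.

Definition sopp n (x : signed n) : signed n := (x.1, ~~ x.2).

Definition no_opposite n (t : {set signed n}) : Prop :=
  forall x, x \in t -> sopp x \notin t.

Record hypercube_graph (n : nat) := HypercubeGraph {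
  edge :> rel (signed n);
  edge_sym : symmetric edge;
  edge_irrefl : irreflexive edge;
  edge_sopp : forall x, ~~ edge x (sopp x)
}.

Section Tubings.
Variables (n : nat) (G : hypercube_graph n).
Implicit Types (t : {set signed n}) (T : {set {set signed n}}).

Definition induces_connected t : Prop :=
  {in t &, forall x y, connect [rel u v | [&& u \in t, v \in t & G u v]] x y}.

Definition tube t : Prop :=
  [/\ t != finset.set0, induces_connected t & no_opposite t].

Definition weakly_compatible t1 t2 : Prop :=
  [\/ t1 \subset t2, t2 \subset t1 |
      (t1 :&: t2)%SET = finset.set0 /\ {in t1 & t2, forall x y, ~~ G x y}].

Definition tubing T : Prop :=
  [/\ {in T, forall t, tube t},
      {in T &, forall t1 t2, weakly_compatible t1 t2} &
      no_opposite (finset.cover T)].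

Definition tubing_complex : set (set {set signed n}) :=
  [set [set` T] | T in tubing].

End Tubings.

(* A simplicial complex is given by its set of simplices; its vertices are the
   elements of its simplices. *)
Definition vertices (X : Type) (K : set (set X)) : set X :=
  \bigcup_(S in K) S.

Definition complex_iso (X Y : Type) (K : set (set X)) (L : set (set Y)) : Prop :=
  exists2 f : X -> Y, set_bij (vertices K) (vertices L) f &
    forall S, S `<=` vertices K -> (K S <-> L (f @` S)).

Section Polytopes.
Variables (R : realType) (m : nat).
Local Notation vec := 'rV[R]_m.
Implicit Types (P F C D : set vec) (c x y : vec) (d : nat).

Definition dot c x : R := \sum_i c 0 i * x 0 i.

Definition halfspace c : set vec := [set x | 0 <= dot c x].

Definition hyperplane c : set vec := [set x | dot c x = 0].

Definition polytope P : Prop :=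
  exists s : seq vec, P = smallest (@convex_set R vec) [set` s].

(* [c] and [b] define a valid inequality on [C]; the empty set and [C] itself
   are allowed as faces. *)
Definition face C F : Prop :=
  exists (c : vec) (b : R),
    (forall x, C x -> dot c x <= b) /\ F = C `&` [set x | dot c x = b].

(* The affine hull of [F] has dimension [d]; the empty set has no dimension. *)
Definition has_dim F d : Prop :=
  exists (x0 : vec) (s : d.-tuple vec),
    [/\ F x0, {in s, forall v, F (x0 + v)}, free s &
        forall y, F y -> y - x0 \in <<s>>%VS].

Definition facet P F : Prop :=
  face P F /\ exists2 k, has_dim P k.+1 & has_dim F k.

Definition simple_polytope d P : Prop :=
  [/\ polytope P, has_dim P d &
      forall v, face P [set v] -> ([set F | facet P F /\ F v] #= `I_d)%card].

(* The condition [P x] matters only for the empty set of facets. *)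
Definition dual_complex P : set (set (set vec)) :=
  [set S | S `<=` facet P /\ exists2 x, P x & forall F, S F -> F x].

(* Outer normals: the linear functionals maximized over [P] on all of [F]. *)
Definition normal_cone P F : set vec :=
  [set c | forall x y, F x -> P y -> dot c y <= dot c x].

Definition normal_fan P : set (set vec) :=
  [set normal_cone P F | F in [set F | face P F /\ F !=set0]].

Definition polyhedral_cone C : Prop :=
  exists s : seq vec, C = \bigcap_(c in [set` s]) halfspace c.

Definition is_fan (N : set (set vec)) : Prop :=
  [/\ finite_set N,
      forall C, N C -> polyhedral_cone C,
      forall C D, N C -> face C D -> D !=set0 -> N D &
      forall C D, N C -> N D -> face C (C `&` D) /\ face D (C `&` D)].

Definition support (N : set (set vec)) : set vec := \bigcup_(C in N) C.

Definition coarsens (N N' : set (set vec)) : Prop :=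
  support N = support N' /\
  forall C, N C -> exists2 M, M `<=` N' & C = \bigcup_(D in M) D.

(* The fan cut out by the hyperplanes with normals in [A]: its cones are the
   intersections obtained by choosing, for each hyperplane, either the
   hyperplane itself or one of its two closed sides. *)
Definition arrangement_fan (A : set vec) : set (set vec) :=
  [set C | exists2 H : vec -> set vec,
     forall a, A a -> [\/ H a = hyperplane a, H a = halfspace a |
                          H a = halfspace (- a)] &
     C = \bigcap_(a in A) H a].

End Polytopes.

Section Hypercube.
Variables (R : realType) (n : nat).

Definition svec (x : signed n) : 'rV[R]_n := (-1) ^+ x.2 *: delta_mx 0 x.1.

Definition typeB_normals : set 'rV[R]_n :=
  [set a | exists i j : 'I_n,
     let ei : 'rV[R]_n := delta_mx 0 i in
     let ej : 'rV[R]_n := delta_mx 0 j in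
     a = ei \/ (i != j /\ (a = ei - ej \/ a = ei + ej))].

Definition typeB_coxeter_fan : set (set 'rV[R]_n) :=
  arrangement_fan typeB_normals.

Definition tubing_cone (T : {set {set signed n}}) : set 'rV[R]_n :=
  [set x | exists2 l : {set signed n} -> R, forall t, t \in T -> 0 <= l t &
     x = \sum_(t in T) l t *: \sum_(i in t) svec i].

Definition hypercube_graph_associahedron (G : hypercube_graph n) (m : nat)
    (P : set 'rV[R]_m) : Prop :=
  simple_polytope n P /\ complex_iso (dual_complex P) (tubing_complex G).

Definition standard_cut (G : hypercube_graph n) (P : set 'rV[R]_n) : Prop :=
  hypercube_graph_associahedron G P /\
  normal_fan P = [set tubing_cone T | T in tubing G].

End Hypercube.

Arguments typeB_coxeter_fan : clear implicits.

(* Main.v *)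
(* A largest tube [t] of a tubing has a vertex lying in no smaller tube, so the
   coefficient of [t] in a point of the tubing cone is the signed coordinate at
   that vertex. Peeling off largest tubes thus shows that the cone of a tubing
   is cut out by inequalities between signed coordinates, which are all given by
   type B hyperplanes: the cone is polyhedral and a union of Coxeter cones. The
   supports agree because every linear form has a maximum on a polytope. Faces
   of tubing cones are spanned by subsets of the generators, that is, by smaller
   tubings; for the intersection of two cones one also uses that both are normal
   cones of the same polytope. *)
Require Import Defs.
From mathcomp Require Import all_boot all_order all_algebra.
From mathcomp Require Import all_classical all_reals.
From mathcomp Require Import interval_inference convex lra.

Set Implicit Arguments.
Unset Strict Implicit.
Unset Printing Implicit Defensive.

Import Order.TTheory GRing.Theory Num.Theory.

Local Open Scope classical_set_scope.
Local Open Scope ring_scope.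

(** * The pairing, maxima over polytopes, normal cones and arrangement cones *)

Section Dot.
Variables (R : realType) (m : nat).
Implicit Types (c x y : 'rV[R]_m) (P F : set 'rV[R]_m).

Lemma dotC c x : dot c x = dot x c.
Proof. by apply: eq_bigr => i _; rewrite mulrC. Qed.

Lemma dotDr c x y : dot c (x + y) = dot c x + dot c y.
Proof. by rewrite /dot -big_split; apply: eq_bigr => i _; rewrite mxE mulrDr. Qed.

Lemma dotZr c k x : dot c (k *: x) = k * dot c x.
Proof. by rewrite /dot mulr_sumr; apply: eq_bigr => i _; rewrite mxE mulrCA. Qed.

Lemma dotNr c x : dot c (- x) = - dot c x.
Proof. by rewrite -scaleN1r dotZr mulN1r. Qed.

Lemma dotBr c x y : dot c (x - y) = dot c x - dot c y.
Proof. by rewrite dotDr dotNr. Qed.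

Lemma dot0r c : dot c 0 = 0.
Proof. by rewrite -(scale0r 0) dotZr mul0r. Qed.

Lemma dot_sumr c (I : Type) (r : seq I) (Q : pred I) (f : I -> 'rV[R]_m) :
  dot c (\sum_(i <- r | Q i) f i) = \sum_(i <- r | Q i) dot c (f i).
Proof.
by apply: (big_morph (dot c)) => [x y|]; [exact: dotDr | exact: dot0r].
Qed.

Lemma dotNl c x : dot (- c) x = - dot c x.
Proof. by rewrite dotC dotNr dotC. Qed.

Lemma dotDl c x y : dot (x + y) c = dot x c + dot y c.
Proof. by rewrite dotC dotDr !(dotC c). Qed.

Lemma dotBl c x y : dot (x - y) c = dot x c - dot y c.
Proof. by rewrite dotDl dotNl. Qed.

Lemma convex_dot_le c b : @convex_set R 'rV[R]_m [set x | dot c x <= b].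
Proof.
apply/convex_setW => x y + + l; rewrite !inE /= => xb yb l0 l1.
change (dot c (l%:num *: (x : 'rV[R]_m) + (1 - l%:num) *: (y : 'rV[R]_m)) <= b).
rewrite dotDr !dotZr.
have -> : b = l%:num * b + (1 - l%:num) * b by rewrite -mulrDl addrC subrK mul1r.
by rewrite lerD// ler_wpM2l// ?subr_ge0 ltW.
Qed.

(** Half-spaces are convex, so a bound on the generators holds on their hull, and the maximum is
    attained at a generator. *)
Lemma polytope_max P c :
  polytope P -> P !=set0 -> exists2 x, P x & forall y, P y -> dot c y <= dot c x.
Proof.
move=> [s ->] [p Pp].
have hull_le b : {in s, forall v, dot c v <= b} ->
    forall y, smallest (@convex_set R 'rV[R]_m) [set` s] y -> dot c y <= b.
  by move=> sb y; apply: (smallest_sub (@convex_dot_le c b)) => v /=; exact: sb.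
case: s p Pp hull_le => [|v s] p Pp hull_le.
  (* With no generators every [b] is a bound, even one below the value at [p]. *)
  have : dot c p <= dot c p - 1 by exact: hull_le.
  by rewrite lerDl oppr_ge0 ler10.
have [i _ iP] := @arg_maxP _ _ 'I_(size s).+1 ord0 xpredT
  (fun i => dot c (nth v (v :: s) i)) isT.
exists (nth v (v :: s) i).
  by apply: sub_gen_smallest => /=; exact: mem_nth.
apply: hull_le => w /nthP-/(_ v)[j jlt <-].
exact: (iP (Ordinal jlt)).
Qed.

Lemma support_normal_fan P : polytope P -> P !=set0 ->
  Defs.support (normal_fan P) = setT.
Proof.
move=> polyP P0; apply/seteqP; split=> // c _.
have [x Px xmax] := polytope_max c polyP P0.
exists (normal_cone P (P `&` [set y | dot c y = dot c x])).
  exists (P `&` [set y | dot c y = dot c x]) => //.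
  by split; [exists c, (dot c x) | exists x].
by move=> y z [_ /= ->] /xmax.
Qed.

(** The alternative [l i = 0] admits generators outside the normal cone when their coefficient
    vanishes. *)
Lemma normal_cone_sum P F (I : finType) (A : {pred I}) (l : I -> R)
    (g : I -> 'rV[R]_m) :
  (forall i, i \in A -> 0 <= l i) ->
  (forall i, i \in A -> l i = 0 \/ normal_cone P F (g i)) ->
  normal_cone P F (\sum_(i in A) l i *: g i).
Proof.
move=> l0 gF x y Fx Py; rewrite ![dot (\sum_(_ in _) _) _]dotC !dot_sumr.
apply: ler_sum => i iA; rewrite !dotZr.
have [->|gi] := gF i iA; first by rewrite !mul0r.
by apply: ler_wpM2l; rewrite ?l0// ![dot _ (g i)]dotC gi.
Qed.

(** Choosing for each hyperplane the side containing [x], or the hyperplane itself when [x] is on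
    it, gives a cone on which every normal keeps its weak sign at [x]. *)
Lemma arrangement_cone_at (A : set 'rV[R]_m) x :
  exists D, [/\ arrangement_fan A D, D x &
    forall z a, D z -> A a ->
      (0 <= dot a x -> 0 <= dot a z) /\ (dot a x <= 0 -> dot a z <= 0)].
Proof.
pose H (a : 'rV[R]_m) : set 'rV[R]_m := if dot a x == 0 then hyperplane a
  else if 0 < dot a x then halfspace a else halfspace (- a).
exists (\bigcap_(a in A) H a); split.
- exists H => // a _; rewrite /H.
  by case: ifP => _; [apply: Or31|case: ifP => _; [apply: Or32|apply: Or33]].
- move=> a _; rewrite /H; case: ltgtP => //= ax;
    by rewrite /halfspace /hyperplane /= ?dotNl ?oppr_ge0 ?ltW.
- move=> z a Dz /Dz; rewrite /H.
  case: ltgtP => _; rewrite /halfspace /hyperplane /= ?dotNl ?oppr_ge0//.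
  by move=> ->.
Qed.

End Dot.

(** * Signed basis vectors and type B normals *)

Section Generators.
Variables (R : realType) (n : nat).
Implicit Types (u v : signed n) (t : {set signed n}) (T : {set {set signed n}}).

Lemma soppK : involutive (@sopp n).
Proof. by case=> i b; rewrite /sopp /= negbK. Qed.

Lemma dot_svec u (x : 'rV[R]_n) : dot (svec R u) x = (-1) ^+ u.2 * x 0 u.1.
Proof.
rewrite /dot (bigD1 u.1)//= big1 ?addr0.
  by rewrite /svec !mxE !eqxx mulr1.
by move=> i /negPf iu; rewrite /svec !mxE iu andbF mulr0 mul0r.
Qed.

Lemma svec_sopp u : svec R (sopp u) = - svec R u.
Proof.
by case: u => i b; rewrite /svec /sopp /= signrN scaleNr.
Qed.

Lemma svecE u : svec R u = delta_mx 0 u.1 \/ svec R u = - delta_mx 0 u.1.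
Proof.
by rewrite /svec; case: u.2; [right; rewrite expr1 scaleN1r|left; rewrite scale1r].
Qed.

Lemma dot_svecs u v :
  dot (svec R u) (svec R v) = (u == v)%:R - (sopp u == v)%:R.
Proof.
rewrite dot_svec !mxE !eqxx /=.
case: u v => [i b] [j c]; rewrite /sopp /= !xpair_eqE.
have [_|_] := eqVneq i j; rewrite ?mulr0 ?subrr//=.
by case: b; case: c; rewrite /= ?expr0 ?expr1; lra.
Qed.

Lemma dot_svec_sum u t :
  dot (svec R u) (\sum_(i in t) svec R i) = (u \in t)%:R - (sopp u \in t)%:R.
Proof.
have sumE w : \sum_(i in t) (w == i)%:R = (w \in t)%:R :> R.
  have [wt|wt] := boolP (w \in t).
    rewrite (big_setD1 w)//= eqxx big1 ?addr0// => i.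
    by rewrite !inE eq_sym => /andP[/negPf->].
  by rewrite big1// => i it; have [wi|//] := eqVneq w i; rewrite wi it in wt.
rewrite dot_sumr; under eq_bigr do rewrite dot_svecs.
by rewrite sumrB !sumE.
Qed.

Lemma typeB_svec u : exists2 a : 'rV[R]_n, typeB_normals a &
  svec R u = a \/ svec R u = - a.
Proof.
exists (delta_mx 0 u.1); last exact: svecE.
by exists u.1, u.1; left.
Qed.

(** Distinct indices exclude [v = sopp u], where the difference is, up to sign, twice a basis vector
    and not a chosen normal. *)
Lemma typeB_svecB u v : u.1 != v.1 -> exists2 a : 'rV[R]_n, typeB_normals a &
  svec R u - svec R v = a \/ svec R u - svec R v = - a.
Proof.
move=> uv; case: (svecE u) => ->; case: (svecE v) => ->.
- exists (delta_mx 0 u.1 - delta_mx 0 v.1); last by left.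
  by exists u.1, v.1; right; split=> //; left.
- exists (delta_mx 0 u.1 + delta_mx 0 v.1); last by left; rewrite opprK.
  by exists u.1, v.1; right; split=> //; right.
- exists (delta_mx 0 u.1 + delta_mx 0 v.1); last by right; rewrite opprD.
  by exists u.1, v.1; right; split=> //; right.
- exists (delta_mx 0 u.1 - delta_mx 0 v.1); last by right; rewrite opprB opprK addrC.
  by exists u.1, v.1; right; split=> //; left.
Qed.

End Generators.

(** * Tubings and the inequalities that describe their cones *)

Section TubingCones.
Variables (R : realType) (n : nat) (G : hypercube_graph n).
Implicit Types (u v : signed n) (s t : {set signed n}) (T : {set {set signed n}}).

Local Notation cone := (@tubing_cone R n).

Lemma tubing_sub T T' : T' \subset T -> tubing G T -> tubing G T'.
Proof.
move=> /fintype.subsetP sT [tubeT wcT opT]; split.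
- by move=> t /sT/tubeT.
- by move=> s t /sT sT' /sT; exact: wcT.
- have cov u : u \in finset.cover T' -> u \in finset.cover T.
    by move=> /bigcupP[t /sT tT ut]; apply/bigcupP; exists t.
  by move=> u /cov/opT; apply: contra => /cov.
Qed.

(** A common vertex rules out disjointness, and the cardinalities turn an inclusion of [t] in [s]
    into equality. *)
Lemma weakly_compatible_subset s t u : weakly_compatible G s t ->
  u \in s -> u \in t -> (#|s| <= #|t|)%N -> s \subset t.
Proof.
move=> wc us ut cst; case: wc => [//|ts|[/finset.setP/(_ u)]].
  by have /eqP-> : t == s by rewrite eqEcard ts.
by rewrite !inE us ut.
Qed.

(* If every vertex of [t] lay in a smaller tube, then a largest such tube would
   be separated from the rest of [t], against connectedness. *)
Lemma tube_top T t : tubing G T -> t \in T ->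
  (forall s, s \in T -> (#|s| <= #|t|)%N) ->
  exists2 u, u \in t & forall s, s \in T -> u \in s -> s = t.
Proof.
move=> [tubeT wcT _] tT tmax.
have sub s u : s \in T -> u \in s -> u \in t -> s \subset t.
  by move=> sT us ut; exact: (weakly_compatible_subset (wcT s t sT tT) us ut (tmax s sT)).
have [t0 tconn _] := tubeT t tT.
have [u0 u0t] := set0Pn _ t0.
case: (boolP [exists u in t, [forall s in T, (u \in s) ==> (s == t)]]).
  move=> /exists_inP[u ut /forall_inP uP]; exists u => // s sT us.
  exact/eqP/(implyP (uP s sT)).
move=> /exists_inPn notop.
have smaller u : u \in t -> exists s, [/\ s \in T, u \in s & s != t].
  move=> /notop /forall_inPn[s sT]; rewrite negb_imply => /andP[us st].
  by exists s.
have [s1 [s1T u0s1 s1t]] := smaller u0 u0t.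
have s1P : [&& s1 \in T, u0 \in s1 & s1 != t] by rewrite s1T u0s1.
case: (arg_maxnP (P := fun s => [&& s \in T, u0 \in s & s != t])
  (fun s => #|s|) s1P) => s /and3P[sT u0s st] smax.
pose e := [rel u v | [&& u \in t, v \in t & G u v]].
have e_sym : connect_sym e.
  by apply: sym_connect_sym => x y; rewrite /= andbCA edge_sym.
(* A neighbour in [t] of a vertex of [s] lies in some tube [s' != t]; the edge forbids separation,
   and maximality of [s] forbids a strictly larger [s']. *)
have s_closed : closed e s.
  apply: (intro_closed e_sym) => x y /and3P[xt yt xy] xs.
  have [s' [s'T ys' s't]] := smaller y yt.
  case: (wcT s s' sT s'T) => [ss'|/fintype.subsetP/(_ y ys')//|[_ noedge]].
    have s'P : [&& s' \in T, u0 \in s' & s' != t].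
      by rewrite s'T s't (fintype.subsetP ss').
    by have /eqP-> : s == s' by rewrite eqEcard ss'; exact: smax.
  by have := noedge x y xs ys'; rewrite xy.
case/eqP: st; apply/eqP; rewrite finset.eqEsubset (sub s u0)//=.
apply/fintype.subsetP => v vt.
by rewrite -(closed_connect s_closed (tconn u0 v u0t vt)).
Qed.

(* For [v] in a tube, the condition on [u] and [v] says that the smallest tube
   containing [u] is included in the smallest tube containing [v]. *)
Definition tubing_region T : set 'rV[R]_n := [set x |
  (forall u, sopp u \notin finset.cover T -> 0 <= dot (svec R u) x) /\
  (forall u v, v \in finset.cover T -> (forall t, t \in T -> v \in t -> u \in t) ->
     dot (svec R v) x <= dot (svec R u) x)].

Lemma dot_svec_tubing T (l : {set signed n} -> R) u :
  sopp u \notin finset.cover T ->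
  dot (svec R u) (\sum_(t in T) l t *: \sum_(i in t) svec R i) =
  \sum_(t in T) l t * (u \in t)%:R.
Proof.
move=> uT; rewrite dot_sumr; apply: eq_bigr => t tT.
rewrite dotZr dot_svec_sum; suff /negPf-> : sopp u \notin t by rewrite subr0.
by apply: contra uT => ut; apply/bigcupP; exists t.
Qed.

(** Signed coordinates at covered vertices are sums of the coefficients of the tubes containing
    them, so more tubes give a larger sum. *)
Lemma tubing_cone_region T : tubing G T -> cone T `<=` tubing_region T.
Proof.
move=> [_ _ opT] _ [l l0 ->]; split=> [u uT|u v vT uv].
  rewrite dot_svec_tubing//; apply: sumr_ge0 => t tT.
  by rewrite mulr_ge0 ?l0.
have uT : u \in finset.cover T.
  by have /bigcupP[t tT vt] := vT; apply/bigcupP; exists t => //; exact: uv.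
rewrite !dot_svec_tubing ?opT//; apply: ler_sum => t tT.
apply: ler_wpM2l; rewrite ?l0// ler_nat.
by have [/(uv t tT)->|] := boolP (v \in t).
Qed.

Lemma region_tubing_cone T : tubing G T -> tubing_region T `<=` cone T.
Proof.
have [k] := ubnP #|T|; elim: k T => // k IH T /ltnSE-Tk tubT x [xpos xle].
have [T0|[s1 s1T]] := set_0Vmem T.
  (* Nothing is covered, so every coordinate and its negative are nonnegative, and [x] is zero. *)
  exists (fun=> 0) => //; rewrite T0 big_set0; apply/rowP => i; rewrite mxE.
  have cov0 u : u \notin finset.cover T.
    by apply/bigcupP => -[t]; rewrite T0 inE.
  have := xpos (i, false) (cov0 _); have := xpos (i, true) (cov0 _).
  rewrite !dot_svec /= expr0 expr1; lra.
case: (arg_maxnP (P := fun s => s \in T) (fun s => #|s|) s1T) => t tT tmax.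
have [tubeT wcT opT] := tubT.
have [_ _ opt] := tubeT t tT.
have [w wt wtop] := tube_top tubT tT tmax.
have coverT s u : s \in T -> u \in s -> u \in finset.cover T.
  by move=> sT us; apply/bigcupP; exists s.
have tcov u : u \in t -> u \in finset.cover T by exact: coverT.
have sub s u : s \in T -> u \in s -> u \in t -> s \subset t.
  by move=> sT us ut; exact: (weakly_compatible_subset (wcT s t sT tT) us ut (tmax s sT)).
(* Only [t] contains [w], so [m] has to be the coefficient of [t]; it is also the least signed
   coordinate on [t]. *)
pose m := dot (svec R w) x.
have m0 : 0 <= m by apply/xpos/opT/tcov.
have m_min u : u \in t -> m <= dot (svec R u) x.
  by move=> ut; apply: xle; [exact: tcov | move=> s sT /(wtop s sT)->].
pose T' := T :\ t.
have T'T : T' \subset T by exact: subsetDl.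
have cov' u : u \in finset.cover T' -> u \in finset.cover T.
  by move=> /bigcupP[s /(fintype.subsetP T'T)]; exact: coverT.
have cov'P u : u \in finset.cover T -> u \notin t -> u \in finset.cover T'.
  move=> /bigcupP[s sT us] ut; apply/bigcupP; exists s => //.
  by rewrite !inE sT andbT; apply: contraNneq ut => <-.
(* A vertex of [t] in no other tube lies in the same tubes as [w], so its coordinate equals [m]. *)
have only_t u : u \in t -> u \notin finset.cover T' -> dot (svec R u) x = m.
  move=> ut uT'; apply/eqP; rewrite eq_le m_min// andbT; apply: xle; first exact: tcov.
  move=> s sT us; suff -> : s = t by [].
  apply/eqP; apply: contraNT uT' => st; apply/bigcupP; exists s => //.
  by rewrite !inE st.
pose x' := x - m *: \sum_(i in t) svec R i.
have x'E u : sopp u \notin t ->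
    dot (svec R u) x' = dot (svec R u) x - m * (u \in t)%:R.
  by move=> /negPf ut; rewrite /x' dotBr dotZr dot_svec_sum ut subr0.
have x'reg : tubing_region T' x'.
  split=> [u uT'|u v vT' uv].
    have [sut|sut] := boolP (sopp u \in t).
      (* Here [sopp u] lies in [t] alone, so its coordinate [m] drops to zero. *)
      have := only_t _ sut uT'; rewrite svec_sopp dotNl => xu.
      rewrite /x' dotBr dotZr dot_svec_sum sut.
      have /negPf-> : u \notin t by rewrite -(soppK u); exact: opt.
      by rewrite sub0r mulrN1 opprK -xu subrr.
    have sucov : sopp u \notin finset.cover T.
      by apply: contra uT' => /cov'P; exact.
    rewrite x'E//; have [ut|_] := boolP (u \in t).
      by rewrite mulr1 subr_ge0; exact: m_min.
    by rewrite mulr0 subr0; exact: xpos.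
  have uT' : u \in finset.cover T'.
    by have /bigcupP[s sT' vs] := vT'; apply/bigcupP; exists s => //; exact: uv.
  have no_sopp z : z \in finset.cover T' -> sopp z \notin t.
    by move=> /cov'/opT; apply: contra => /tcov.
  (* A tube of [T'] containing [u] and [v] is inside [t] or disjoint from it, so the subtraction
     shifts both coordinates equally. *)
  have uvt : (u \in t) = (v \in t).
    have /bigcupP[s sT' vs] := vT'.
    have us := uv s sT' vs; have sT := fintype.subsetP T'T s sT'.
    apply/idP/idP => h; first exact: (fintype.subsetP (sub s u sT us h)).
    exact: (fintype.subsetP (sub s v sT vs h)).
  rewrite !x'E ?no_sopp// uvt lerD2r; apply: xle; first exact: cov'.
  move=> s sT vs; have [st|st] := eqVneq s t; first by rewrite st uvt -st.
  by apply: uv vs; rewrite !inE st.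
have T'k : (#|T'| < k)%N by move: Tk; rewrite (cardsD1 t) tT.
have [l l0 x'l] := IH T' T'k (tubing_sub T'T tubT) x' x'reg.
exists (fun s => if s == t then m else l s).
  move=> s sT; case: eqVneq => [//|st]; apply: l0; by rewrite !inE st.
rewrite (big_setD1 t)//= eqxx -[LHS](subrK (m *: \sum_(i in t) svec R i)) -/x' addrC.
congr (_ + _); rewrite x'l; apply: eq_bigr => s.
by rewrite !inE => /andP[/negPf->].
Qed.

Lemma tubing_coneE T : tubing G T -> cone T = tubing_region T.
Proof.
by move=> tT; apply/seteqP; split; [exact: tubing_cone_region|exact: region_tubing_cone].
Qed.

Lemma tubing_cone_polyhedral T : tubing G T -> polyhedral_cone (cone T).
Proof.
move=> tT; rewrite tubing_coneE//.
pose p1 := [pred u | sopp u \notin finset.cover T].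
pose p2 := [pred q : signed n * signed n | (q.2 \in finset.cover T) &&
  [forall t in T, (q.2 \in t) ==> (q.1 \in t)]].
exists ([seq svec R u | u in p1] ++ [seq svec R q.1 - svec R q.2 | q in p2]).
apply/seteqP; split=> [x [x1 x2] c|x xc].
  rewrite /= mem_cat => /orP[/fintype.imageP[u uT ->]|/fintype.imageP[[u v] /andP[/= vT uv] ->]].
    exact: x1.
  rewrite /halfspace /= dotBl subr_ge0; apply: x2 => // t tT' vt.
  exact: (implyP (forall_inP uv t tT')).
split=> [u uT|u v vT uv].
  by apply: (xc (svec R u)); rewrite /= mem_cat; apply/orP; left; apply: fintype.image_f.
rewrite -subr_ge0 -dotBl; apply: (xc (svec R u - svec R v)).
rewrite /= mem_cat; apply/orP; right.
apply: (fintype.image_f (fun q => svec R q.1 - svec R q.2) (x := (u, v))).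
rewrite inE /= vT; apply/forall_inP => t tT'; apply/implyP; exact: uv.
Qed.

(** The nontrivial inequalities of the region have type B normals up to sign, so they persist on a
    Coxeter cone that keeps the signs of a point satisfying them. *)
Lemma tubing_cone_typeB T : tubing G T ->
  exists2 M, M `<=` typeB_coxeter_fan R n & cone T = \bigcup_(D in M) D.
Proof.
move=> tT; exists [set D | typeB_coxeter_fan R n D /\ D `<=` cone T].
  by move=> D [].
apply/seteqP; split=> [x|x [D [_ DT]] /DT//].
rewrite tubing_coneE// => -[x1 x2].
have [D [fanD Dx Dsign]] := arrangement_cone_at (@typeB_normals R n) x.
exists D => //; split=> // z Dz.
have side b : (exists2 a : 'rV[R]_n, typeB_normals a & b = a \/ b = - a) ->
    0 <= dot b x -> 0 <= dot b z.
  move=> [a /(Dsign z a Dz)[pos neg] [->|->]]; first exact: pos.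
  by rewrite !dotNl !oppr_ge0.
split=> [u uT|u v vT uv].
  by apply: side; [exact: typeB_svec|exact: x1].
have [<-//|nuv] := eqVneq u v.
rewrite -subr_ge0 -dotBl; apply: side; last by rewrite dotBl subr_ge0; exact: x2.
(* If [u] and [v] shared an index they would be equal or opposite, and a tubing covers no opposite
   pair. *)
apply: typeB_svecB; apply: contra_neq nuv => uv1.
have [_ _ opT] := tT.
have uT : u \in finset.cover T.
  by have /bigcupP[t tT' vt] := vT; apply/bigcupP; exists t => //; exact: uv.
have [uv2|uv2] := eqVneq u.2 v.2; first by apply/eqP; rewrite -pair_eqE /pair_eq uv1 uv2 !eqxx.
suff vu : v = sopp u by have := opT u uT; rewrite -vu vT.
apply/eqP; rewrite -pair_eqE /pair_eq /= uv1 eqxx /=.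
by move: uv2; case: u.2; case: v.2.
Qed.

(** * Faces and intersections of tubing cones *)

Lemma tubing_cone_mem T t : t \in T -> cone T (\sum_(i in t) svec R i).
Proof.
move=> tT; exists (fun s => (s == t)%:R) => //.
rewrite (big_setD1 t)//= eqxx scale1r [X in _ + X]big1 ?addr0// => s.
by rewrite !inE => /andP[/negPf->]; rewrite scale0r.
Qed.

Lemma tubing_cone_scale T k x : 0 <= k -> cone T x -> cone T (k *: x).
Proof.
move=> k0 [l l0 ->]; exists (fun t => k * l t) => [t tT|].
  by rewrite mulr_ge0 ?l0.
by rewrite scaler_sumr; apply: eq_bigr => t _; rewrite scalerA.
Qed.

(** A nonempty face of a cone is cut out by a hyperplane through the origin and is spanned by the
    generators on it. *)
Lemma tubing_cone_face T D : tubing G T -> face (cone T) D -> D !=set0 ->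
  exists2 T', tubing G T' & D = cone T'.
Proof.
move=> tT [c [b [cb ->]]] [p [Tp /= cp]].
(* Scaling [p] by 2 and by 0 stays in the cone, which gives [2 b <= b] and [0 <= b]. *)
have b0 : b = 0.
  have := cb _ (tubing_cone_scale (ler0n R 2) Tp).
  have := cb _ (tubing_cone_scale (lexx 0) Tp).
  rewrite !dotZr cp; lra.
rewrite {}b0 in cb cp *.
pose T' := [set t in T | dot c (\sum_(i in t) svec R i) == 0]%SET.
have T'T : T' \subset T by apply/fintype.subsetP => t; rewrite inE => /andP[].
exists T'; first exact: tubing_sub T'T tT.
have sumT' (l : {set signed n} -> R) : {in T, forall t, t \notin T' -> l t = 0} ->
    \sum_(t in T) l t *: (\sum_(i in t) svec R i) =
    \sum_(t in T') l t *: (\sum_(i in t) svec R i).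
  move=> lT'; rewrite (big_setID T')/= (finset.setIidPr T'T) [X in _ + X]big1 ?addr0// => t.
  by rewrite inE => /andP[tT' tT0]; rewrite lT' ?scale0r.
apply/seteqP; split=> x.
  move=> [[l l0 xl] /= cx]; exists l => [t /(fintype.subsetP T'T)/l0//|].
  rewrite xl; apply: sumT' => t tT0.
  have term_le s : s \in T -> 0 <= - (l s * dot c (\sum_(i in s) svec R i)).
    by move=> sT; rewrite -mulrN mulr_ge0 ?l0// oppr_ge0; apply/cb/tubing_cone_mem.
  (* All terms have the same sign and sum to zero, so a generator off the hyperplane has coefficient
     zero. *)
  have : \sum_(s in T) - (l s * dot c (\sum_(i in s) svec R i)) = 0.
    rewrite sumrN; apply/eqP; rewrite oppr_eq0 -[X in _ == X]cx xl dot_sumr.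
    by apply/eqP/eq_bigr => s _; rewrite dotZr.
  move/psumr_eq0P => /(_ term_le)/(_ t tT0)/eqP.
  by rewrite inE tT0/= oppr_eq0 mulf_eq0 => /orP[/eqP//|->].
move=> [l l0 xl]; split.
  exists (fun t => if t \in T' then l t else 0).
    by move=> t _; case: ifP => // /l0.
  rewrite sumT' => [|t _ /negPf->//]; rewrite xl; apply: eq_bigr => t ->//.
rewrite /= xl dot_sumr big1// => t.
by rewrite inE dotZr => /andP[_ /eqP->]; rewrite mulr0.
Qed.

(* The linear form exposing the intersection is [sum_t (y_t - p)], where [p] is
   in [F] and, for each generator [t] of the first cone lying outside the second
   one, [y_t] is a point of [F'] at which that generator is not maximal. *)
Lemma tubing_normal_cone_face P F F' T :
  F `<=` P -> F' `<=` P -> F !=set0 -> cone T = normal_cone P F ->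
  face (normal_cone P F) (normal_cone P F `&` normal_cone P F').
Proof.
move=> FP F'P [p Fp] TF.
pose g (t : {set signed n}) := \sum_(i in t) svec R i.
have gF t : t \in T -> normal_cone P F (g t).
  by move=> tT; rewrite -TF; exact: tubing_cone_mem.
have [y yP] : {y : {set signed n} -> 'rV[R]_n & forall t, t \in T ->
    ~ normal_cone P F' (g t) -> F' (y t) /\ dot (g t) (y t) < dot (g t) p}.
  apply: (@choice _ _ (fun t z => t \in T -> ~ normal_cone P F' (g t) ->
    F' z /\ dot (g t) z < dot (g t) p)) => t.
  have [tT|] := boolP (t \in T); last by exists 0.
  (* A failure at [x] in [F'] against [z] in [P] is also one against [p], where the generator is
     maximal over [P]. *)
  have [|/existsNP[x /existsNP[z /not_implyP[F'x /not_implyP[Pz]]]]] :=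
    pselect (normal_cone P F' (g t)); first by exists 0.
  move=> /negP; rewrite -ltNge => xz; exists x => _ _; split=> //.
  exact: lt_le_trans xz (gF t tT p z Fp Pz).
pose bad t := (t \in T) && ~~ `[< normal_cone P F' (g t) >].
have badP t : bad t -> F' (y t) /\ dot (g t) (y t) < dot (g t) p.
  by move=> /andP[tT /asboolPn]; exact: yP.
have wE c : dot (\sum_(t | bad t) (y t - p)) c = \sum_(t | bad t) (dot c (y t) - dot c p).
  by rewrite dotC dot_sumr; apply: eq_bigr => t _; rewrite dotBr.
have term_le c t : normal_cone P F c -> bad t -> dot c (y t) - dot c p <= 0.
  by move=> Fc /badP[F'y _]; rewrite subr_le0; exact: Fc Fp (F'P _ F'y).
exists (\sum_(t | bad t) (y t - p)), 0; split=> [c Fc|].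
  by rewrite wE; apply: sumr_le0 => t; exact: term_le.
apply/seteqP; split=> c [Fc].
  move=> F'c; split=> //; rewrite /= wE big1// => t badt.
  apply/eqP; rewrite eq_le term_le//= subr_ge0.
  by have [F'y _] := badP t badt; exact: F'c F'y (FP _ Fp).
rewrite /= wE => wc0; split=> //.
(* On the first cone every summand is nonpositive, so a zero sum makes [c] agree at [p] and each
   [y t]. *)
have cy t : bad t -> dot c p - dot c (y t) = 0.
  apply: (psumr_eq0P (F := fun t => dot c p - dot c (y t))) => [s bads|].
    by rewrite -opprB oppr_ge0; exact: term_le.
  apply/eqP; rewrite -oppr_eq0 -sumrN -[X in _ == X]wc0; apply/eqP.
  by apply: eq_bigr => s _; rewrite opprB.
move: (Fc); rewrite -TF => -[l l0 cE].
rewrite cE; apply: normal_cone_sum => // t tT.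
have [|F't] := pselect (normal_cone P F' (g t)); [by right|left].
have badt : bad t by rewrite /bad tT; exact/asboolPn.
have [F'y ylt] := badP t badt.
(* Every generator is maximal at [p], so agreement of [c] at [p] and [y t] makes each term vanish;
   the gap for [t] is strict, hence [l t = 0]. *)
have sum0 : \sum_(s in T) l s * (dot (g s) p - dot (g s) (y t)) = 0.
  transitivity (dot c (p - y t)); last by rewrite dotBr cy.
  rewrite dotC cE dot_sumr; apply: eq_bigr => s _.
  by rewrite dotZr [dot (_ - _) _]dotC dotBr.
have term0 s : s \in T -> 0 <= l s * (dot (g s) p - dot (g s) (y t)).
  move=> sT; apply: mulr_ge0; first exact: l0.
  by rewrite subr_ge0; exact: gF Fp (F'P _ F'y).
have /eqP := psumr_eq0P term0 sum0 tT.
by rewrite mulf_eq0 [X in _ || X]gt_eqF ?subr_gt0// orbF => /eqP.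
Qed.

End TubingCones.

Theorem proposition4p3p2 (R : realType) (n : nat) (G : hypercube_graph n)
    (P : set 'rV[R]_n) :
  standard_cut G P ->
  is_fan (normal_fan P) /\ coarsens (normal_fan P) (typeB_coxeter_fan R n).
Proof.
move=> [[[polyP [x0 [s [Px0 _ _ _]]] _] _] fanE].
split; last first.
  split.
    rewrite support_normal_fan//; last by exists x0.
    apply/seteqP; split=> // x _.
    by have [D [fanD Dx _]] := arrangement_cone_at (@typeB_normals R n) x; exists D.
  by move=> C; rewrite fanE => -[T tT <-]; exact: tubing_cone_typeB tT.
split.
- by rewrite fanE; apply: finite_image; exact: finite_finset.
- by move=> C; rewrite fanE => -[T tT <-]; exact: tubing_cone_polyhedral tT.
- move=> C D; rewrite fanE => -[T tT <-] faceD D0.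
  by have [T' tT' ->] := tubing_cone_face tT faceD D0; exists T'.
have faceP F : face P F -> F `<=` P by move=> [c [b [_ ->]]] x [].
(* [C] is at once a tubing cone, which provides generators, and a normal cone of [P]. *)
have meet C D : normal_fan P C -> normal_fan P D -> face C (C `&` D).
  move=> NC [F' [faceF' _] <-]; move: (NC) => [F [faceF F0] FC].
  move: NC; rewrite fanE => -[T _ TC]; rewrite -FC.
  by apply: (@tubing_normal_cone_face _ _ P F F' T); rewrite ?TC//; exact: faceP.
by move=> C D NC ND; split; [exact: meet | rewrite setIC; exact: meet].
Qed.
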